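(* Let $k\ge 1$, let $a_1,\ldots,a_k$ be nonnegative integers and let $S\subseteq\{1,\ldots,k\}$. The number of $(a_1,\ldots,a_k,S)$-derangements is the coefficient of $x_1^{a_1}\cdots x_k^{a_k}$ in the formal power series $$\frac{1}{1-x_1-\cdots-x_k}\left(\frac{\prod_{i\in\{1,\ldots,k\},\, i\notin S}(1-x_i)}{\prod_{i\in S}(1+x_i)}\right).$$
   Context: Let $n=a_1+\cdots+a_k$ and partition $\{1,\ldots,n\}$ into consecutive blocks $A_1,\ldots,A_k$ (in this order) with $|A_i|=a_i$, i.e. $A_i=\{a_1+\cdots+a_{i-1}+1,\ldots,a_1+\cdots+a_i\}$ (blocks may be empty). An $(a_1,\ldots,a_k,S)$-permutation is a permutation $\pi$ of $\{1,\ldots,n\}$ that descends within each block $A_i$ with $i\in S$ (that is, $\pi(j)>\pi(j+1)$ whenever $j,j+1\in A_i$) and ascends within each block $A_i$ with $i\notin S$ (that is, $\pi(j)<\pi(j+1)$ whenever $j,j+1\in A_i$); no condition is imposed between different blocks. An $(a_1,\ldots,a_k,S)$-derangement is an $(a_1,\ldots,a_k,S)$-permutation with no fixed points, i.e. no $j$ with $\pi(j)=j$. For $n=0$ the unique (empty) permutation counts as a derangement. Empty products equal $1$. *)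

(* Defs.v *)
From HB Require Import structures.
From mathcomp Require Import all_boot all_order all_algebra all_fingroup.
From mathcomp Require Import mpoly boolp.

Set Implicit Arguments.
Unset Strict Implicit.
Unset Printing Implicit Defensive.

Import GRing.Theory.

Local Open Scope ring_scope.

(* Formal power series in n commuting variables over R: arbitrary families of
   coefficients indexed by the exponent vectors 'X_{1.. n} of multinomials. *)
Record fps (n : nat) (R : Type) := FPS { fps_coef : 'X_{1.. n} -> R }.

HB.instance Definition _ n R := gen_eqMixin (fps n R).
HB.instance Definition _ n R := gen_choiceMixin (fps n R).

Lemma fpsP n R (f g : fps n R) : fps_coef f =1 fps_coef g <-> f = g.
Proof.
split=> [|->//]; case: f g => [f] [g] /= efg; congr FPS.
exact: functional_extensionality_dep.
Qed.

Section FpsZmod.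
Variables (n : nat) (R : zmodType).
Implicit Types f g h : fps n R.

Definition fps0 : fps n R := FPS (fun _ => 0).
Definition fps_opp f : fps n R := FPS (fun m => - fps_coef f m).
Definition fps_add f g : fps n R := FPS (fun m => fps_coef f m + fps_coef g m).

Fact fps_addA : associative fps_add.
Proof. by move=> f g h; apply/fpsP => m; apply: addrA. Qed.
Fact fps_addC : commutative fps_add.
Proof. by move=> f g; apply/fpsP => m; apply: addrC. Qed.
Fact fps_add0 : left_id fps0 fps_add.
Proof. by move=> f; apply/fpsP => m; apply: add0r. Qed.
Fact fps_addN : left_inverse fps0 fps_opp fps_add.
Proof. by move=> f; apply/fpsP => m; apply: addNr. Qed.

HB.instance Definition _ :=
  GRing.isZmodule.Build (fps n R) fps_addA fps_addC fps_add0 fps_addN.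

Lemma fps_coef0 m : fps_coef (0 : fps n R) m = 0. Proof. by []. Qed.
Lemma fps_coefN f m : fps_coef (- f) m = - fps_coef f m. Proof. by []. Qed.
Lemma fps_coefD f g m : fps_coef (f + g) m = fps_coef f m + fps_coef g m.
Proof. by []. Qed.
Lemma fps_coefB f g m : fps_coef (f - g) m = fps_coef f m - fps_coef g m.
Proof. by []. Qed.

Lemma fps_coef_sum I (r : seq I) (P : pred I) (F : I -> fps n R) m :
  fps_coef (\sum_(i <- r | P i) F i) m = \sum_(i <- r | P i) fps_coef (F i) m.
Proof. by elim/big_rec2: _ => // i x y _ <-. Qed.

End FpsZmod.

Section FpsRing.
Variables (n : nat) (R : comNzRingType).
Implicit Types f g h : fps n R.
Implicit Types m : 'X_{1.. n}.

Definition fpsC (c : R) : fps n R := FPS (fun m => if m == 0%MM then c else 0).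
Definition fpsX (i : 'I_n) : fps n R := FPS (fun m => (m == U_(i)%MM)%:R).

(* Cauchy product; every h <= m has degree at most that of m, so the bounded
   index type only serves to make the sum visibly finite. *)
Definition fps_mul f g : fps n R := FPS (fun m =>
  \sum_(h : 'X_{1.. n < (mdeg m).+1} | (h <= m)%MM)
     fps_coef f h * fps_coef g (m - h)%MM).

Definition fps_trunc (d : nat) f : {mpoly R[n]} :=
  \sum_(h : 'X_{1.. n < d}) fps_coef f h *: 'X_[h].

Lemma mcoeff_trunc d f m : (mdeg m < d)%N -> (fps_trunc d f)@_m = fps_coef f m.
Proof.
move=> lt_md; rewrite /fps_trunc raddf_sum /= (bigD1 (BMultinom lt_md)) //=.
rewrite mcoeffZ mcoeffX eqxx mulr1 big1 ?addr0 // => h neq_h.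
rewrite mcoeffZ mcoeffX (_ : _ == _ = false) ?mulr0 //.
by apply: contraNF neq_h => /eqP eq_h; apply/eqP/val_inj.
Qed.

Lemma fps_mulE f g (p q : {mpoly R[n]}) (m : 'X_{1.. n}) :
    (forall e : 'X_{1.. n}, (e <= m)%MM -> p@_e = fps_coef f e) ->
    (forall e : 'X_{1.. n}, (e <= m)%MM -> q@_e = fps_coef g e) ->
  fps_coef (fps_mul f g) m = (p * q)@_m.
Proof.
move=> pE qE; rewrite (mcoeff_poly_mul_lin p q (ltnSn (mdeg m))) /=.
apply: eq_bigr => h le_hm; rewrite pE // qE //.
by apply/mnm_lepP => i; rewrite mnmBE leq_subr.
Qed.

Lemma mnm_lep_mdeg (h m : 'X_{1.. n}) : (h <= m)%MM -> (mdeg h <= mdeg m)%N.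
Proof. by move=> le_hm; rewrite -(submK le_hm) mdegD leq_addl. Qed.

Lemma mcoeff_truncM d f g m : (mdeg m < d)%N ->
  fps_coef (fps_mul f g) m = (fps_trunc d f * fps_trunc d g)@_m.
Proof.
move=> lt_md; apply: fps_mulE => // h /mnm_lep_mdeg le_hm;
  exact/mcoeff_trunc/(leq_ltn_trans le_hm).
Qed.

Fact fps_mulA : associative fps_mul.
Proof.
move=> f g h; apply/fpsP => m; set d := (mdeg m).+1.
have le_d (e : 'X_{1.. n}) : (e <= m)%MM -> (mdeg e < d)%N by move/mnm_lep_mdeg.
rewrite (@fps_mulE _ _ (fps_trunc d f) (fps_trunc d g * fps_trunc d h)).
- rewrite (@fps_mulE _ _ (fps_trunc d f * fps_trunc d g) (fps_trunc d h)).
  + by rewrite mulrA.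
  + by move=> e /le_d le_e; rewrite (mcoeff_truncM _ _ le_e).
  + by move=> e /le_d le_e; rewrite mcoeff_trunc.
- by move=> e /le_d le_e; rewrite mcoeff_trunc.
- by move=> e /le_d le_e; rewrite (mcoeff_truncM _ _ le_e).
Qed.

Fact fps_mulC : commutative fps_mul.
Proof.
by move=> f g; apply/fpsP => m; rewrite !(mcoeff_truncM _ _ (ltnSn _)) mulrC.
Qed.

Fact fps_mul1 : left_id (fpsC 1) fps_mul.
Proof.
move=> f; apply/fpsP => m; set d := (mdeg m).+1.
rewrite (@fps_mulE _ _ 1 (fps_trunc d f)).
- by rewrite mul1r mcoeff_trunc.
- by move=> e _ /=; rewrite mcoeff1; case: eqP.
- by move=> e /mnm_lep_mdeg le_e; rewrite mcoeff_trunc.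
Qed.

Fact fps_mulDl : left_distributive fps_mul +%R.
Proof.
move=> f g h; apply/fpsP => m /=; rewrite -big_split /=.
by apply: eq_bigr => e _; rewrite mulrDl.
Qed.

Fact fps_oner_neq0 : fpsC 1 != 0.
Proof.
apply/eqP => /(congr1 (fun f => fps_coef f 0%MM)) /= /eqP.
by rewrite eqxx oner_eq0.
Qed.

HB.instance Definition _ := GRing.Zmodule_isComNzRing.Build (fps n R)
  fps_mulA fps_mulC fps_mul1 fps_mulDl fps_oner_neq0.

Lemma fps_coefM f g m :
  fps_coef (f * g) m = \sum_(h : 'X_{1.. n < (mdeg m).+1} | (h <= m)%MM)
                          fps_coef f h * fps_coef g (m - h)%MM.
Proof. by []. Qed.

Lemma fps_coefC c m : fps_coef (fpsC c) m = if m == 0%MM then c else 0.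
Proof. by []. Qed.

Lemma fps_coef1 m : fps_coef (1 : fps n R) m = (m == 0%MM)%:R.
Proof. by rewrite fps_coefC; case: eqP. Qed.

Lemma fps_coefX i m : fps_coef (fpsX i) m = (m == U_(i)%MM)%:R.
Proof. by []. Qed.

Lemma fps_coefCM c f m : fps_coef (fpsC c * f) m = c * fps_coef f m.
Proof.
set d := (mdeg m).+1; rewrite (@fps_mulE _ _ c%:MP (fps_trunc d f)).
- by rewrite mcoeffCM mcoeff_trunc.
- by move=> e _; rewrite mcoeffC fps_coefC; case: eqP; rewrite ?mulr1 ?mulr0.
- by move=> e /mnm_lep_mdeg le_e; rewrite mcoeff_trunc.
Qed.

Lemma fps_coef0M f g :
  fps_coef (f * g) 0%MM = fps_coef f 0%MM * fps_coef g 0%MM.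
Proof.
rewrite (mcoeff_truncM _ _ (ltnSn _)) rmorphM /=.
by rewrite !mcoeff_trunc ?mdeg0.
Qed.

Lemma fps_coefX_lt f j m :
  fps_coef f 0%MM = 0 -> (mdeg m < j)%N -> fps_coef (f ^+ j) m = 0.
Proof.
move=> f0; elim: j m => // j IHj m lt_mj; rewrite exprS fps_coefM big1 // => h.
have [-> _|nz_h le_hm] := eqVneq (h : 'X_{1.. n}) 0%MM; first by rewrite f0 mul0r.
rewrite IHj ?mulr0 //; move: lt_mj; rewrite -{1}(submK le_hm) mdegD ltnS.
by apply: leq_trans; rewrite -addn1 leq_add2l lt0n mdeg_eq0.
Qed.

End FpsRing.

Section FpsUnit.
Variables (n : nat) (R : comUnitRingType).
Implicit Types f g : fps n R.

Definition fps_unit : pred (fps n R) :=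
  fun f => fps_coef f 0%MM \is a GRing.unit.

(* With c the constant coefficient of f and u := 1 - c^-1 f, the inverse of f
   is c^-1 * (1 + u + u^2 + ...); as u has no constant term, u^j does not
   contribute to the coefficient of a monomial of degree less than j. *)
Definition fps_inv f : fps n R :=
  if fps_unit f then
    let c := fps_coef f 0%MM in
    FPS (fun m => c^-1 *
      \sum_(j < (mdeg m).+1) fps_coef ((1 - fpsC n c^-1 * f) ^+ j) m)
  else f.

Fact fps_mulVf : {in fps_unit, left_inverse 1 fps_inv *%R}.
Proof.
move=> f uf; rewrite mulrC /fps_inv ifT //.
move: uf; rewrite -topredE /= /fps_unit /=; set c := fps_coef f 0%MM => uc.
set u := 1 - _; set G := FPS _.
have u0 : fps_coef u 0%MM = 0.
  by rewrite fps_coefB fps_coefCM fps_coef1 eqxx mulVr ?subrr.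
have fE : f = fpsC n c * (1 - u).
  apply/fpsP => m; rewrite /u opprB addrC subrK !fps_coefCM.
  by rewrite mulrA mulrV ?mul1r.
apply/fpsP => m; pose d := (mdeg m).+1.
have GE (h : 'X_{1.. n}) : (h <= m)%MM ->
    fps_coef G h = fps_coef (fpsC n c^-1 * \sum_(j < d) u ^+ j) h.
  move=> /mnm_lep_mdeg le_hm; rewrite fps_coefCM fps_coef_sum /=; congr (_ * _).
  rewrite (big_ord_widen d (fun j => fps_coef (u ^+ j) h)) //.
  rewrite big_mkcond /=; apply: eq_bigr => j _; case: ltnP => // lt_hj.
  by rewrite fps_coefX_lt.
transitivity (fps_coef (f * (fpsC n c^-1 * \sum_(j < d) u ^+ j)) m).
  rewrite !fps_coefM; apply: eq_bigr => h le_hm; rewrite GE //.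
  by apply/mnm_lepP => i; rewrite mnmBE leq_subr.
rewrite {1}fE mulrACA; have -> : fpsC n c * fpsC n c^-1 = 1.
  apply/fpsP => h; rewrite fps_coefCM !fps_coefC.
  by case: eqP; rewrite ?mulr0 // mulrV.
have -> : (1 - u) * \sum_(j < d) u ^+ j = 1 - u ^+ d.
  by rewrite -[in RHS](expr1n _ d) subrXX; congr (_ * _);
     apply: eq_bigr => j _; rewrite expr1n mul1r.
by rewrite mul1r fps_coefB fps_coefX_lt ?subr0.
Qed.

Fact fps_unitPl f g : g * f = 1 -> fps_unit f.
Proof.
move=> /(congr1 (fun h => fps_coef h 0%MM)); rewrite fps_coef0M fps_coef1 eqxx.
by move=> gf1; apply/unitrPr; exists (fps_coef g 0%MM); rewrite mulrC.
Qed.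

Fact fps_inv_out : {in [predC fps_unit], fps_inv =1 id}.
Proof. by move=> f nuf; rewrite /fps_inv ifN. Qed.

HB.instance Definition _ := GRing.ComNzRing_hasMulInverse.Build (fps n R)
  fps_mulVf fps_unitPl fps_inv_out.

Lemma fps_unitE f :
  (f \is a GRing.unit) = (fps_coef f 0%MM \is a GRing.unit).
Proof. by []. Qed.

End FpsUnit.

Arguments fpsC {n R} c.
Arguments fpsX {n R} i.

Section Permutations.
Local Open Scope nat_scope.
Variables (k : nat) (a : 'I_k -> nat) (S : {set 'I_k}).

(* The set permuted is {0, ..., n - 1} rather than {1, ..., n}; this affects
   neither descents, ascents nor fixed points. *)
Definition block (i : 'I_k) : {set 'I_(\sum_i a i)} :=
  [set j : 'I_(\sum_i a i) |
    \sum_(l < k | l < i) a l <= j < \sum_(l < k | l <= i) a l].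

Definition block_perm (s : 'S_(\sum_i a i)) : bool :=
  [forall i : 'I_k, forall j in block i, forall j' in block i,
    (j' == j.+1 :> nat) ==> (if i \in S then s j' < s j else s j < s j')].

Definition block_derangement (s : 'S_(\sum_i a i)) : bool :=
  block_perm s && [forall j, s j != j].

End Permutations.

(* Main.v *)
Require Import Defs.
From mathcomp Require Import all_boot all_order all_algebra all_fingroup.
From mathcomp Require Import mpoly.
From mathcomp Require Import zify.

Set Implicit Arguments.
Unset Strict Implicit.
Unset Printing Implicit Defensive.

Import GRing.Theory.
Local Open Scope ring_scope.

(** Fix the set S of descending blocks. For a set U of blocks let F_U(m) be the
number of permutations that are monotone on each block, in the direction
prescribed by S, and that have no fixed point in the blocks of U; here m is the
vector of block sizes. The theorem is about F_U for U the set of all blocks,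
and the proof deletes one point (p, s p) of a permutation at a time.

With no restriction on fixed points, the largest value of a nonempty
permutation is found at the start of a descending block or at the end of an
ascending one, and deleting it is a bijection once this block i is known
([card_admissible_max]). So F_0(m) is the sum of F_0(m - U_i) over the nonempty
blocks i, which says that the series of F_0 is 1 / (1 - x_1 - ... - x_k)
([admissible_series_set0]).

Now let i be a block outside U. A permutation counted by F_U either has no
fixed point in block i, or can be stripped of its first fixed point there. The
stripped permutation s determines where the point was: s lies strictly on one
side of the diagonal on an initial part of block i ([before_initial]), and the
deleted point separates that part from the rest. If block i ascends, every s
counted by F_U arises. If block i descends, a fixed point of block i is the
only one there, so precisely the s without fixed points in block i arise. This
is [card_admissible_fixed], and it gives
<<
  F_U(m) = F_{U+i}(m) + F_U(m - U_i)        if block i ascends,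
  F_U(m) = F_{U+i}(m) + F_{U+i}(m - U_i)    if block i descends.
>>
On series, adding i to U thus multiplies by 1 - x_i in the first case and
divides by 1 + x_i in the second ([admissible_series_step]). Adding the blocks
one after the other turns the series of F_0 into the required one
([admissible_seriesE]). *)

(** * Permutations with a prescribed value deleted *)

(** Together with the next lemma: deleting the point (p, q) is a bijection from
the permutations that map p to q to the permutations of one point less. *)
Lemma lift_perm_onto N (p q : 'I_N.+1) (s : 'S_N.+1) :
  s p = q -> exists t, s = lift_perm p q t.
Proof.
move=> spq; pose t j := odflt j (unlift q (s (lift p j))).
have tE j : lift q (t j) = s (lift p j).
  rewrite /t; case: unliftP => //= sj; case/negP: (neq_lift p j).
  by apply/eqP/(@perm_inj _ s); rewrite spq.
have t_inj : injective t.
  move=> j j' /(congr1 (lift q)); rewrite !tE => /perm_inj; apply: lift_inj.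
exists (perm t_inj); apply/permP => x.
case: (unliftP p x) => [j|] ->; last by rewrite lift_perm_id.
by rewrite lift_perm_lift permE tE.
Qed.

Lemma lift_perm_inj N (p q : 'I_N.+1) : injective (@lift_perm N p q).
Proof.
move=> s t eq_st; apply/permP => j; apply: (@lift_inj _ q).
by rewrite -!(lift_perm_lift p) eq_st.
Qed.

(** * Blocks of consecutive positions *)

Section BlockCounting.
Local Open Scope nat_scope.
Variable k : nat.
Implicit Types (m : 'X_{1.. k}) (i l : 'I_k) (U : {set 'I_k}).

(** The bound x is a number and not a block, so that the end of block i is
[block_start m i.+1] and the total size is [block_start m k]. *)
Definition block_start m (x : nat) := \sum_(l < k | l < x) m l.

Lemma block_startD m i x :
  block_start (m + U_(i)) x = block_start m x + (i < x).
Proof.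
rewrite /block_start; under eq_bigr do rewrite mnmDE mnm1E.
rewrite big_split /=; congr (_ + _); rewrite big_mkcond (bigD1 i) //= eqxx.
rewrite big1 ?addn0 => [|l]; first by case: ifP.
by rewrite eq_sym => /negPf->; case: ifP.
Qed.

Lemma leq_block_start m x y : x <= y -> block_start m x <= block_start m y.
Proof.
move=> le_xy; rewrite /block_start big_mkcond [leqRHS]big_mkcond.
rewrite leq_sum //= => l _.
by case: ifP => // lt_lx; rewrite (leq_trans lt_lx le_xy).
Qed.

Lemma block_startS m i : block_start m i.+1 = block_start m i + m i.
Proof.
rewrite /block_start (bigD1 i) //= addnC; congr (_ + _).
by apply: eq_bigl => l; rewrite ltnS ltn_neqAle andbC.
Qed.

Lemma block_start_mdeg m : block_start m k = mdeg m.
Proof. by rewrite mdegE; apply: eq_bigl => l; rewrite ltn_ord. Qed.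

Definition in_block m i (x : nat) := block_start m i <= x < block_start m i.+1.

Lemma in_block_inj m i l x : in_block m i x -> in_block m l x -> i = l.
Proof.
rewrite /in_block => xi xl; apply: val_inj => /=.
case: (ltngtP i l) => // /leq_block_start le_il; have := le_il m; lia.
Qed.

Lemma in_block_exists m x : x < mdeg m -> exists i, in_block m i x.
Proof.
rewrite -block_start_mdeg => lt_x.
have [|y lt_y min_y] := @ex_minnP (fun y => x < block_start m y).
  by exists k.
case: y lt_y min_y => [|y lt_y min_y].
  by rewrite /block_start big1.
have lt_yk : y < k by have := min_y _ lt_x.
exists (Ordinal lt_yk); rewrite /in_block /= lt_y andbT leqNgt.
by apply/negP => /min_y; rewrite ltnn.
Qed.

(** Which block a position other than p falls into does not depend on where p
sits inside block i: this lets the insertion of a point be described block by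
block. *)
Lemma in_block_bump m i p l x : in_block (m + U_(i)) i p ->
  in_block (m + U_(i)) l (bump p x) = in_block m l x.
Proof.
rewrite /in_block !block_startD ltnn ltnSn ltnS /bump => p_i.
case: (ltngtP l i) => [lt_li|lt_il|/val_inj->].
- by have := leq_block_start m lt_li; lia.
- by have := leq_block_start m lt_il; lia.
- by lia.
Qed.

(** * Monotone permutations and their fixed points *)

Section Fix_S.
Variable S : {set 'I_k}.

Definition before i (x y : nat) := if i \in S then y < x else x < y.

(** All pairs of positions in a block are compared, not only adjacent ones:
adjacency is not preserved when a position between the two is deleted or
inserted. *)
Definition block_monotone N m (s : 'S_N) :=
  [forall i, forall j : 'I_N, forall j' : 'I_N,
     [&& in_block m i j, in_block m i j' & j < j'] ==> before i (s j) (s j')].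

Definition no_fixed N m U (s : 'S_N) :=
  [forall i in U, forall j : 'I_N, in_block m i j ==> (s j != j)].

Definition admissible N m U : {set 'S_N} :=
  [set s | block_monotone m s && no_fixed m U s].

Lemma block_monotoneP N m (s : 'S_N) :
  reflect (forall i (j j' : 'I_N), in_block m i j -> in_block m i j' ->
             j < j' -> before i (s j) (s j'))
          (block_monotone m s).
Proof.
apply: (iffP idP) => [mono i j j' ij ij' ltj|mono].
  move/forallP/(_ i)/forallP/(_ j)/forallP/(_ j')/implyP: mono.
  by apply; apply/and3P.
apply/forallP => i; apply/forallP => j; apply/forallP => j'; apply/implyP.
by case/and3P; apply: mono.
Qed.

Lemma no_fixedP N m U (s : 'S_N) :
  reflect (forall i (j : 'I_N), i \in U -> in_block m i j -> s j != j)
          (no_fixed m U s).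
Proof.
apply: (iffP idP) => [nf i j iU ij|nf].
  by move/forall_inP/(_ i iU)/forallP/(_ j)/implyP: nf; apply.
by apply/forall_inP => i iU; apply/forallP => j; apply/implyP; apply: nf.
Qed.

Lemma adjacent_block_monotone N m (s : 'S_N) :
    (forall i (j j' : 'I_N), in_block m i j -> in_block m i j' ->
       j' = j.+1 :> nat -> before i (s j) (s j')) ->
  block_monotone m s.
Proof.
move=> step; apply/block_monotoneP => i j j'.
move: {2}(j' - j) (erefl (j' - j)) => d.
elim: d j' => [|d IHd] j' dj ij ij' lt_jj'; first by lia.
have [eq_j|neq_j] := eqVneq (j' : nat) j.+1; first exact: (step i).
have lt_N : j'.-1 < N by have := ltn_ord j'; lia.
have lt_jx : j < j'.-1 by lia.
pose x := Ordinal lt_N.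
have ix : in_block m i x by move: ij ij'; rewrite /in_block /=; lia.
have := step i x j' ix ij'; have := IHd x _ ij ix lt_jx.
rewrite /= prednK; last by lia.
move=> /(_ ltac:(lia)) + /(_ erefl).
by rewrite /before; case: ifP => _; lia.
Qed.

(** The new point (p, q) has to be compared only with the points of its own
block i; in each direction, this says that the values below q are on the
appropriate side of p. *)
Lemma block_monotone_lift N m i (p q : 'I_N.+1) (s : 'S_N) :
    in_block (m + U_(i)) i p ->
  block_monotone (m + U_(i)) (lift_perm p q s) <->
  block_monotone m s /\
  forall j : 'I_N, in_block m i j -> (s j < q) = (j < p) (+) (i \in S).
Proof.
move=> p_i; have bE l (j : 'I_N) := in_block_bump l j p_i.
split=> [/block_monotoneP mono|[/block_monotoneP mono sq]].
  split=> [|j j_i].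
    apply/block_monotoneP => l j j' jl j'l ltj.
    have := mono l (lift p j) (lift p j'); rewrite !lift_perm_lift /= !bE.
    by move/(_ jl j'l); rewrite /before /bump; case: ifP => _; lia.
  have := mono i (lift p j) p; have := mono i p (lift p j).
  rewrite !lift_perm_lift lift_perm_id /= bE => /(_ p_i j_i) H1 /(_ j_i p_i).
  move: H1; rewrite /before /bump; case: (i \in S) => /=; lia.
apply/block_monotoneP => l x x'.
case: (unliftP p x) => [j|] ->; case: (unliftP p x') => [j'|] ->.
- rewrite !lift_perm_lift /= !bE => jl j'l ltj.
  have := mono l j j' jl j'l; move: ltj.
  by rewrite /before /bump; case: ifP => _; lia.
- rewrite lift_perm_lift lift_perm_id /= bE => jl pl.
  rewrite -(in_block_inj p_i pl) in jl *; have := sq j jl.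
  by rewrite /before /bump; case: (i \in S) => /=; lia.
- rewrite lift_perm_lift lift_perm_id /= bE => pl jl.
  rewrite -(in_block_inj p_i pl) in jl *; have := sq j' jl.
  by rewrite /before /bump; case: (i \in S) => /=; lia.
- by rewrite ltnn.
Qed.

Lemma no_fixed_lift N m i U (p : 'I_N.+1) (s : 'S_N) :
    i \notin U -> in_block (m + U_(i)) i p ->
  no_fixed (m + U_(i)) U (lift_perm p p s) = no_fixed m U s.
Proof.
move=> iU p_i; have bE l (j : 'I_N) := in_block_bump l j p_i.
apply/no_fixedP/no_fixedP => nf l j lU jl.
  have := nf l (lift p j) lU; rewrite /= bE => /(_ jl).
  by rewrite lift_perm_lift; apply: contra_neq => ->.
case: (unliftP p j) jl => [j'|] ->.
  rewrite /= bE lift_perm_lift => /(nf _ _ lU).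
  by apply: contra_neq => /lift_inj.
by move/(in_block_inj p_i) => il; rewrite il lU in iU.
Qed.

Lemma admissible_setU1 N m i U (s : 'S_N) :
  (s \in admissible N m (i |: U)) =
  (s \in admissible N m U) && no_fixed m [set i] s.
Proof.
rewrite !inE -andbA; congr (_ && _); apply/no_fixedP/andP.
  move=> nf; split; apply/no_fixedP => l j lU; apply: nf; rewrite !inE.
    by rewrite lU orbT.
  by move: lU; rewrite inE => ->.
case=> /no_fixedP nfU /no_fixedP nfi l j; rewrite inE => /orP[].
  exact: nfi.
exact: nfU.
Qed.

(** * Deleting the first fixed point of a block *)

(** In other words, s j - j is weakly increasing on an ascending block, as s is
strictly increasing with integer values. *)
Lemma ascending_gap N m i (s : 'S_N) (j j' : 'I_N) :
    block_monotone m s -> i \notin S ->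
    in_block m i j -> in_block m i j' -> j <= j' ->
  s j + j' <= s j' + j.
Proof.
move=> /block_monotoneP mono iS; move: {2}(j' - j) (erefl (j' - j)) => d.
elim: d j' => [|d IHd] j' dE ij ij' lej.
  by rewrite (_ : j' = j) //; apply: val_inj => /=; lia.
have lt_N : j'.-1 < N by have := ltn_ord j'; lia.
pose x := Ordinal lt_N.
have xi : in_block m i x by move: ij ij'; rewrite /in_block /=; lia.
have := IHd x; have := mono i x j' xi ij'; rewrite /before (negPf iS) /=.
by move=> H1 H2; have := H2 _ ij xi; lia.
Qed.

(** The points (j, s j) with [before i (s j) j] are below the diagonal if block
i ascends and above it if block i descends; in both cases they come first in the
block. *)
Lemma before_initial N m i (s : 'S_N) (j j' : 'I_N) :
    block_monotone m s -> in_block m i j -> in_block m i j' -> j <= j' ->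
  before i (s j') j' -> before i (s j) j.
Proof.
move=> mono ij ij' lej; rewrite /before; case: ifPn => iS.
  move/block_monotoneP: mono => /(_ i j j' ij ij'); rewrite /before iS.
  case: (ltngtP j j') lej => // [|/val_inj->//]; lia.
have := ascending_gap mono iS ij ij' lej; lia.
Qed.

(** Such a p is the only place where a fixed point can be inserted into s so as
to become the first fixed point of block i. *)
Definition separates N m i (s : 'S_N) (p : 'I_N.+1) :=
  in_block (m + U_(i)) i p &&
  [forall j : 'I_N, in_block m i j ==> (before i (s j) j == (j < p))].

Lemma separatesP N m i (s : 'S_N) (p : 'I_N.+1) :
  reflect (in_block (m + U_(i)) i p /\
           forall j : 'I_N, in_block m i j -> before i (s j) j = (j < p))
          (separates m i s p).
Proof.
apply: (iffP andP) => -[-> sp]; first split=> // j ij.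
  by apply/eqP; move/forallP/(_ j)/implyP: sp; apply.
by split=> //; apply/forallP => j; apply/implyP => /sp->.
Qed.

Lemma separates_inj N m i (s : 'S_N) (p p' : 'I_N.+1) :
  separates m i s p -> separates m i s p' -> p = p'.
Proof.
wlog ltp : p p' / p < p' => [gen|].
  case: (ltngtP p p') => [lt|lt sp sp'|/val_inj//]; first exact: gen.
  by apply/esym/gen.
case/separatesP; rewrite /in_block !block_startD ltnn ltnS leqnn => p_i sp.
case/separatesP; rewrite /in_block !block_startD ltnn ltnS leqnn => p'_i sp'.
have lt_N : p < N by have := ltn_ord p'; lia.
have /= := sp' (Ordinal lt_N); have /= := sp (Ordinal lt_N).
by rewrite /in_block ltnn ltp => -> ; lia.
Qed.

Lemma separates_exists m i (s : 'S_(mdeg m)) :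
  block_monotone m s -> exists p, separates m i s p.
Proof.
move=> mono.
have le_e : block_start m i.+1 <= mdeg m.
  by rewrite -block_start_mdeg leq_block_start.
pose P x := (block_start m i <= x) &&
  [forall j : 'I_(mdeg m), in_block m i j && (x <= j) ==> ~~ before i (s j) j].
have Pe : P (block_start m i.+1).
  rewrite /P leq_block_start //=; apply/forallP => j; apply/implyP.
  by rewrite /in_block; lia.
have [|x /andP[le_x /forallP Px] min_x] := @ex_minnP P.
  by exists (block_start m i.+1).
have lt_x : x < (mdeg m).+1 by have := min_x _ Pe; lia.
exists (Ordinal lt_x); apply/separatesP; split=> [|j ij] /=.
  rewrite /in_block !block_startD ltnn ltnS leqnn /=.
  by have := min_x _ Pe; lia.
case: ltnP => [lt_jx|le_xj]; last first.
  by apply/negbTE; move/implyP: (Px j); apply; rewrite ij.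
have /negbTE : ~~ P j by apply/negP => /min_x; lia.
rewrite /P; move: (ij); rewrite /in_block => /andP[-> _] /= /negbT.
rewrite negb_forall => /existsP[j']; rewrite negb_imply negbK.
by case/andP => /andP[ij' le_jj']; exact: (before_initial mono ij ij' le_jj').
Qed.

(** In an ascending block s j < j < p and p <= j <= s j leave no choice. In a
descending block, s j and p could only be on the wrong sides of each other if
s j were itself a position of the block between j and p; comparing the values
at j and at s j then contradicts descent. A fixed point j of s would be no
contradiction, and it does obstruct the insertion. *)
Lemma separates_lift_monotone N m i (s : 'S_N) (p : 'I_N.+1) :
    block_monotone m s -> separates m i s p ->
    (i \in S -> no_fixed m [set i] s) ->
  block_monotone (m + U_(i)) (lift_perm p p s).
Proof.
move=> mono /separatesP[p_i sp] nf.
apply/block_monotone_lift => //; split=> // j ij.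
move: p_i; rewrite /in_block !block_startD ltnn ltnSn => p_i.
have := sp j ij.
case iS: (i \in S) nf => nf; rewrite /before iS /=; last by lia.
have neq_j : s j != j :> nat.
  by move/no_fixedP: (nf isT) => /(_ i j); rewrite inE eqxx; apply.
move/block_monotoneP: mono => mono; have := sp (s j).
move: ij (mono i j (s j)) (mono i (s j) j); rewrite /before iS /in_block; lia.
Qed.

(** Being first matters only in an ascending block, where several adjacent
positions may be fixed. *)
Lemma monotone_lift_separates N m i (s : 'S_N) (p : 'I_N.+1) :
    in_block (m + U_(i)) i p ->
    block_monotone (m + U_(i)) (lift_perm p p s) ->
    (forall x : 'I_N.+1, in_block (m + U_(i)) i x ->
       lift_perm p p s x = x -> p <= x) ->
  separates m i s p.
Proof.
move=> p_i mono first_p; apply/separatesP; split=> // j ij.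
have [_ /(_ j ij)] := (block_monotone_lift p s p_i).1 mono.
rewrite /before; case: (boolP (i \in S)) => iS; first by case: (ltnP j p); lia.
have ltj : in_block (m + U_(i)) i (lift p j) by rewrite in_block_bump.
case: (ltnP j p) => [lt_jp|le_pj]; last first.
  have := ascending_gap mono iS p_i ltj.
  rewrite lift_perm_id lift_perm_lift /= /bump; lia.
have := first_p (lift p j) ltj; rewrite lift_perm_lift => first_j _.
have neq_j : s j != j :> nat.
  apply/negP => /eqP/val_inj sj; rewrite sj /= /bump in first_j.
  by have := first_j erefl; lia.
have := ascending_gap mono iS ltj p_i.
rewrite lift_perm_id lift_perm_lift /= /bump; lia.
Qed.

(** A descending block has at most one fixed point. *)
Lemma descending_lift_no_fixed N m i (s : 'S_N) (p : 'I_N.+1) : i \in S ->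
    in_block (m + U_(i)) i p ->
    block_monotone (m + U_(i)) (lift_perm p p s) ->
  no_fixed m [set i] s.
Proof.
move=> iS p_i mono; have [_ sq] := (block_monotone_lift p s p_i).1 mono.
apply/no_fixedP => l j; rewrite inE => /eqP-> /sq; rewrite iS.
by apply: contra_eqN => /eqP->; case: ltnP.
Qed.

(** The last term counts the permutations on the left that have a fixed point in
block i: they are recovered from what remains when the first such point is
deleted, by inserting it at the separating position. *)
Lemma card_admissible_fixed m i U : i \notin U ->
  #|admissible (mdeg m).+1 (m + U_(i)) U| =
  #|admissible (mdeg m).+1 (m + U_(i)) (i |: U)| +
  #|admissible (mdeg m) m (if i \in S then i |: U else U)|.
Proof.
move=> iU; set B := admissible _ m _; set C := admissible _ _ (i |: U).
have sub_C : C \subset admissible (mdeg m).+1 (m + U_(i)) U.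
  by apply/subsetP => s; rewrite admissible_setU1 => /andP[].
have B_U s : s \in B -> [/\ block_monotone m s, no_fixed m U s
                          & i \in S -> no_fixed m [set i] s].
  rewrite /B; case: ifP => _; rewrite ?admissible_setU1 inE; last by case/andP.
  by case/andP => /andP[].
pose pt (s : 'S_(mdeg m)) := odflt ord0 [pick p | separates m i s p].
have ptP s : s \in B -> separates m i s (pt s).
  case/B_U => mono _ _; have [p sp] := separates_exists i mono.
  rewrite /pt.
  by case: pickP => //= /(_ p); rewrite sp.
rewrite -(cardsID C) (setIidPr sub_C); congr (_ + _).
have f_inj : {in B &, injective (fun s => lift_perm (pt s) (pt s) s)}.
  move=> s s' sB s'B /= eq_st.
  (* If pt s came before pt s', the position pt s would be fixed by the lift of
     s' and hence by s', although s' is off the diagonal before pt s'. *)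
  have eq_pt : pt s = pt s'.
    wlog ltp : s s' sB s'B eq_st / pt s < pt s' => [gen|].
      case: (ltngtP (pt s) (pt s')) => [lt|lt|/val_inj//]; first exact: gen.
      by apply/esym/gen.
    have [p_i _] := separatesP _ _ _ _ (ptP s sB).
    have [p'_i sp'] := separatesP _ _ _ _ (ptP s' s'B).
    have := congr1 (fun t : 'S__ => t (pt s)) eq_st; rewrite lift_perm_id.
    case: (unliftP (pt s') (pt s)) ltp p_i => [j ->|->]; last by rewrite ltnn.
    rewrite lift_perm_lift in_block_bump // => ltp ij /lift_inj js.
    have := sp' j ij; rewrite /before -js.
    by case: ifP => _; move: ltp => /=; rewrite /bump; lia.
  by move: eq_st; rewrite eq_pt => /lift_perm_inj.
rewrite -(card_in_imset f_inj).
apply: eq_card => t; apply/setDP/imsetP => [[tU tC]|[s sB ->]].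
  rewrite admissible_setU1 tU /= in tC.
  move: tU tC; rewrite inE => /andP[mono nfU].
  rewrite negb_forall_in => /exists_inP[l]; rewrite inE => /eqP-> {l}.
  rewrite negb_forall => /existsP[x0]; rewrite negb_imply negbK => fix_x0.
  pose fixed (x : 'I_(mdeg m).+1) :=
    in_block (m + U_(i)) i x && (t x == x).
  case: (@arg_minnP _ x0 fixed (@nat_of_ord _) fix_x0).
  move=> p /andP[p_i /eqP tp] min_p.
  have [s ts] := lift_perm_onto tp.
  rewrite /fixed {fixed t fix_x0}ts in mono nfU tp min_p *.
  have sp : separates m i s p.
    apply: monotone_lift_separates => // x x_i xx.
    by rewrite min_p // x_i xx /=.
  have [mono_s _] := (block_monotone_lift p s p_i).1 mono.
  have sB : s \in B.
    have sU : s \in admissible (mdeg m) m U.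
      by rewrite inE mono_s -(no_fixed_lift _ iU p_i).
    rewrite /B; case: ifP => // iS; rewrite admissible_setU1 sU.
    exact: descending_lift_no_fixed mono.
  by exists s => //; rewrite (separates_inj (ptP s sB) sp).
have [mono nfU nfi] := B_U s sB; have sp := ptP s sB.
have [p_i _] := separatesP _ _ _ _ sp.
split; first by rewrite inE no_fixed_lift // nfU separates_lift_monotone.
rewrite admissible_setU1 negb_and; apply/orP; right; apply/negP.
move/no_fixedP/(_ i (pt s)); rewrite inE eqxx lift_perm_id eqxx.
by move/(_ isT p_i).
Qed.

(** * Deleting the maximum *)

(** The maximum can only be at the start of block i if that block descends, and
at its end if it ascends; conversely, any monotone permutation
can be extended there. *)
Lemma card_admissible_max m i :
  #|[set t in admissible (mdeg m).+1 (m + U_(i)) set0 |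
       in_block (m + U_(i)) i ((t^-1)%g ord_max)]| =
  #|admissible (mdeg m) m set0|.
Proof.
have nf0 N m' (s : 'S_N) : no_fixed m' set0 s.
  by apply/no_fixedP => l j; rewrite inE.
have le_e : block_start m i.+1 <= mdeg m.
  by rewrite -block_start_mdeg leq_block_start.
have le_se := leq_block_start m (leqnSn i).
pose e := if i \in S then block_start m i else block_start m i.+1.
have lt_e : e < (mdeg m).+1 by rewrite /e; case: ifP; lia.
pose p := Ordinal lt_e.
have p_i : in_block (m + U_(i)) i p.
  by rewrite /in_block !block_startD ltnn ltnSn /= /e; case: ifP; lia.
rewrite -(card_imset _ (@lift_perm_inj _ p ord_max)); apply: eq_card => t.
rewrite !inE nf0 andbT.
apply/andP/imsetP => [[mono q_i]|[s s_adm ->]]; last first.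
  move: s_adm; rewrite inE => /andP[mono _].
  have -> : (lift_perm p ord_max s)^-1%g ord_max = p.
    by apply/(@perm_inj _ (lift_perm p ord_max s)); rewrite permKV lift_perm_id.
  split=> //.
  apply/block_monotone_lift => //; split=> // j.
  rewrite ltn_ord /in_block /= /e.
  by case: (i \in S); case: ltnP => //; lia.
have tq : t ((t^-1)%g ord_max) = ord_max by rewrite permKV.
have [s ts] := lift_perm_onto tq.
move: q_i ts mono; set q := (t^-1)%g ord_max => q_i ts; rewrite {1}ts.
move=> /(block_monotone_lift _ _ q_i)[mono sq].
exists s; first by rewrite inE mono nf0.
rewrite {1}ts; congr (lift_perm _ _ _); apply: val_inj => /=.
move: q_i; rewrite /in_block !block_startD ltnn ltnSn => q_i.
rewrite /e; case: (boolP (i \in S)) sq => iS sq; apply/eqP.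
  rewrite eqn_leq; apply/andP; split; last by lia.
  rewrite leqNgt; apply/negP => lt_q.
  have lt_N : block_start m i < mdeg m by have := ltn_ord q; lia.
  have := sq (Ordinal lt_N); rewrite ltn_ord /in_block /= lt_q.
  by move/(_ ltac:(lia)).
rewrite eqn_leq; apply/andP; split; first by lia.
rewrite leqNgt; apply/negP => lt_q.
have lt_N : q < mdeg m by lia.
have := sq (Ordinal lt_N); rewrite ltn_ord /in_block /= ltnn.
by move/(_ ltac:(lia)).
Qed.

Lemma card_admissible_set0 m : m != 0%MM ->
  #|admissible (mdeg m) m set0| =
  \sum_(i | m i != 0) #|admissible (mdeg (m - U_(i))) (m - U_(i)) set0|.
Proof.
rewrite -mdeg_eq0; case dN: (mdeg m) => [|N] // _.
set A := admissible _ _ _.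
have -> : #|A| = \sum_i #|[set t in A | in_block m i ((t^-1)%g ord_max)]|.
  under eq_bigr do rewrite -sum1_card.
  under eq_bigr do under eq_bigl do rewrite inE.
  under eq_bigr do rewrite big_mkcondr.
  rewrite exchange_big -sum1_card; apply: eq_bigr => t _.
  have [|i t_i] := @in_block_exists m ((t^-1)%g ord_max).
    by rewrite dN ltn_ord.
  rewrite (bigD1 i) //= t_i big1 // => l; case: ifP => // t_l.
  by rewrite (in_block_inj t_i t_l) eqxx.
rewrite [RHS]big_mkcond; apply: eq_bigr => i _; case: eqP => [mi0|/eqP mi] /=.
  apply: eq_card0 => t; rewrite inE /in_block block_startS mi0 addn0.
  by apply/negP => /andP[_]; lia.
have mE : m = (m - U_(i) + U_(i))%MM by rewrite submK // lep1mP.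
have dN' : mdeg (m - U_(i)) = N.
  by apply: succn_inj; rewrite -dN {2}mE mdegD mdeg1 addn1.
by rewrite -(card_admissible_max (m - U_(i)) i) dN' -mE.
Qed.

End Fix_S.
End BlockCounting.

(** * Generating series *)

Section Series.
Variables (k : nat) (S : {set 'I_k}).
Implicit Types (m : 'X_{1.. k}) (f : fps k int) (U : {set 'I_k}).

Lemma fps_coefXM (R : comNzRingType) (i : 'I_k) (f : fps k R) m :
  fps_coef (fpsX i * f) m = if m i != 0%N then fps_coef f (m - U_(i))%MM else 0.
Proof.
rewrite fps_coefM; case: ifPn => [mi|].
  have le_m : (U_(i) <= m)%MM by rewrite lep1mP.
  have lt_d : (mdeg U_(i)%MM < (mdeg m).+1)%N by rewrite ltnS mnm_lep_mdeg.
  rewrite (bigD1 (BMultinom lt_d)) //= eqxx mul1r.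
  rewrite big1 ?addr0 // => h /andP[_ neq].
  rewrite (_ : _ == _ = false) ?mul0r //.
  by apply: contraNF neq => /eqP eqh; apply/eqP/val_inj.
rewrite -lep1mP => nle; rewrite big1 // => h le_h /=.
rewrite (_ : _ == _ = false) ?mul0r //.
by apply: contraNF nle => /eqP <-.
Qed.

Definition admissible_series U : fps k int :=
  FPS (fun m => Posz #|admissible S (mdeg m) m U|).

Lemma admissible_series_set0 :
  (1 - \sum_i fpsX i) * admissible_series set0 = 1.
Proof.
apply/fpsP => m.
rewrite mulrBl mul1r mulr_suml fps_coefB fps_coef_sum fps_coef1.
under eq_bigr do rewrite fps_coefXM.
rewrite -big_mkcond /=; have [->|nz_m] := eqVneq m 0%MM.
  rewrite big_pred0 => [|i]; last by rewrite mnm0E.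
  rewrite subr0; congr Posz; rewrite mdeg0; apply/eqP/cards1P; exists 1%g.
  apply/setP => s; rewrite !inE permS0 eqxx; apply/andP; split.
    by apply/block_monotoneP => i [].
  by apply/no_fixedP => i [].
rewrite card_admissible_set0 // -natz natr_sum.
by apply/eqP; rewrite subr_eq0; apply/eqP/eq_bigr => i _; rewrite natz.
Qed.

Lemma admissible_series_step i U : i \notin U ->
  admissible_series U = admissible_series (i |: U) +
    fpsX i * admissible_series (if i \in S then i |: U else U).
Proof.
move=> iU; apply/fpsP => m; rewrite fps_coefD fps_coefXM /=.
case: ifPn => [mi|].
  have mE : m = (m - U_(i) + U_(i))%MM by rewrite submK // lep1mP.
  have dE : mdeg m = (mdeg (m - U_(i))).+1 by rewrite {1}mE mdegD mdeg1 addn1.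
  rewrite -PoszD dE.
  by have := card_admissible_fixed S (m - U_(i)) iU; rewrite -mE => ->.
rewrite negbK addr0 => /eqP mi; congr Posz; apply: eq_card => s.
rewrite admissible_setU1 andbC; case: no_fixedP => // -[] l j.
rewrite inE => /eqP->.
by rewrite /in_block block_startS mi addn0; lia.
Qed.

(** The identity is cross-multiplied so as to be proved without inverses, by
adding the elements of U one by one. *)
Lemma admissible_seriesE U :
  admissible_series U * \prod_(i in U | i \in S) (1 + fpsX i) =
  admissible_series set0 * \prod_(i in U | i \notin S) (1 - fpsX i).
Proof.
have [n] := ubnP #|U|; elim: n U => // n IHn U; rewrite ltnS => le_U.
have [->|[i iU]] := set_0Vmem U.
  by rewrite ![\prod_(_ in _ | _) _]big_pred0 ?mulr1 // => l; rewrite inE.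
have i'U : i \notin U :\ i by rewrite !inE eqxx.
have step := admissible_series_step i'U; rewrite setD1K // in step.
have prodE (P : pred 'I_k) F : \prod_(l in U | P l) F l =
    (if P i then F i else 1) * \prod_(l in U :\ i | P l) F l :> fps k int.
  rewrite big_mkcondr (bigD1 i) //=; congr (_ * _); rewrite [RHS]big_mkcondr.
  by apply: eq_bigl => l; rewrite !inE andbC.
have IH :
    admissible_series (U :\ i) * \prod_(l in U :\ i | l \in S) (1 + fpsX l) =
    admissible_series set0 * \prod_(l in U :\ i | l \notin S) (1 - fpsX l).
  by apply: IHn; move: le_U; rewrite (cardsD1 i) iU.
rewrite !prodE [RHS]mulrCA -IH !mulrA; congr (_ * _).
case: (i \in S) step => /= step.
  by rewrite step mul1r mulrDr mulr1 [_ * fpsX i]mulrC.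
by rewrite mulr1 mulrBl mul1r {1}step addrK.
Qed.

Lemma fps_coefX0 (i : 'I_k) : fps_coef (fpsX i : fps k int) 0%MM = 0.
Proof. by rewrite fps_coefX eq_sym mnm1_eq0. Qed.

End Series.

(** * The enumeration of derangements *)

Lemma block_derangementE k (S : {set 'I_k}) (a : 'I_k -> nat)
    (s : 'S_(\sum_i a i)%N) :
  block_derangement S s = (s \in admissible S _ [multinom a i | i < k] setT).
Proof.
set m := [multinom _ | _ < _].
have bsE x : (\sum_(l < k | l < x) a l)%N = block_start m x.
  by apply: eq_bigr => l _; rewrite mnmE.
have bE i j : (j \in block a i) = in_block m i j.
  by rewrite inE bsE (bsE i.+1).
have dE : mdeg m = (\sum_i a i)%N.
  by rewrite mdegE; apply: eq_bigr => i _; rewrite mnmE.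
rewrite inE; congr (_ && _); last first.
  apply/forallP/no_fixedP => [nf i j _ _|nf j]; first exact: nf.
  have [|i ij] := @in_block_exists _ m j; first by rewrite dE.
  exact: nf (in_setT i) ij.
apply/idP/idP => [adj|/block_monotoneP mono]; last first.
  apply/forallP => i; apply/forall_inP => j; rewrite bE => ij.
  apply/forall_inP => j'; rewrite bE => ij'; apply/implyP => /eqP jj'.
  by have := mono i j j' ij ij'; rewrite jj' ltnSn => /(_ isT).
apply: adjacent_block_monotone => l x y lx ly /eqP xy.
move/forallP/(_ l)/forall_inP/(_ x): adj.
by rewrite bE => /(_ lx)/forall_inP/(_ y); rewrite bE => /(_ ly)/implyP/(_ xy).
Qed.

Theorem theorem3p1 (k : nat) (hk : (1 <= k)%N) (a : 'I_k -> nat)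
    (S : {set 'I_k}) :
  Posz #|[set s : 'S_(\sum_i a i)%N | block_derangement S s]| =
  fps_coef
    (1 / (1 - \sum_(i < k) fpsX i)
     * ((\prod_(i < k | i \notin S) (1 - fpsX i))
        / (\prod_(i < k | i \in S) (1 + fpsX i))) : fps k int)
    [multinom a i | i < k].
Proof.
set m := [multinom _ | _ < _].
have -> : Posz #|[set s : 'S_(\sum_i a i)%N | block_derangement S s]| =
          fps_coef (admissible_series S setT) m.
  rewrite /= (_ : mdeg m = \sum_i a i)%N; last first.
    by rewrite mdegE; apply: eq_bigr => i _; rewrite mnmE.
  by congr Posz; apply: eq_card => s; rewrite inE block_derangementE.
congr (fps_coef _ m).
have uP : \prod_(i < k | i \in S) (1 + fpsX i) \is a @GRing.unit (fps k int).
  apply: rpred_prod => i _.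
  by rewrite fps_unitE fps_coefD fps_coef1 eqxx fps_coefX0 addr0 unitr1.
have uQ : 1 - \sum_(i < k) fpsX i \is a @GRing.unit (fps k int).
  rewrite fps_unitE fps_coefB fps_coef1 eqxx fps_coef_sum.
  rewrite big1 ?subr0 ?unitr1 //.
  by move=> i _; apply: fps_coefX0.
have f0 : 1 / (1 - \sum_(i < k) fpsX i) = admissible_series S set0.
  by apply: (mulIr uQ); rewrite mulrVK // mulrC admissible_series_set0.
apply: (mulIr uP); rewrite f0 mulrA mulrVK //.
have := admissible_seriesE S setT.
by under eq_bigl do rewrite inE; under [in RHS]eq_bigl do rewrite inE.
Qed.
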